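(* Let $m\le l$ be positive integers and let $A(x)=(a_{ij}(x))_{m\times l}$ and $B(x)=(b_{ij}(x))_{m\times l}$ be matrices with entries $a_{ij}(x),b_{ij}(x)\in\mathbb{Z}[x]$. Then the following are equivalent: (1) for all $n\in\mathbb{Z}$, the integer matrices $A(n)$ and $B(n)$ are equivalent; (2) for $k=1,2,\dots,m$, $D_k(A(x))=D_k(B(x))$; (3) for $k=1,2,\dots,m$, $d_k(A(x))=d_k(B(x))$; (4) $\mathrm{smith}(A(x))=\mathrm{smith}(B(x))$.
   Context: Two $m\times l$ integer matrices $M,N$ are equivalent if $N=UMV$ for some $U\in GL_m(\mathbb{Z})$, $V\in GL_l(\mathbb{Z})$. An integer-valued quasi-polynomial is a function $f:\mathbb{Z}\to\mathbb{Z}$ for which there exist a positive integer $T$ and polynomials $f_0,\dots,f_{T-1}\in\mathbb{Z}[x]$ such that $f(Tm+i)=f_i(m)$ for all $m\in\mathbb{Z}$ and $0\le i\le T-1$; write $f=(T,\{f_i\}_{i=0}^{T-1})$ (a representation with period $T$; any two such functions have representations with a common period). $R$ denotes the commutative ring of all integer-valued quasi-polynomials with pointwise operations; $\mathbb{Z}[x]\subset R$ via evaluation. Order: for $r=(T,\{r_i\})\in R$, $r\succcurlyeq 0$ means each $r_i$ is $0$ or has positive leading coefficient; $r\succ 0$ means each $r_i$ is nonzero with positive leading coefficient; $f\preccurlyeq g$ means $g-f\succcurlyeq 0$, and $f\prec g$ means $g-f\succ 0$. For $g\in\mathbb{Z}[x]$, $|g|$ is $g$, $-g$ or $0$ according as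 $g\succ0$, $g\prec 0$ or $g=0$. Quotient: for $f,g\in\mathbb{Z}[x]$ with $g\ne0$ there are unique $P,r\in R$ with $f=Pg+r$ and $0\preccurlyeq r\prec|g|$; put $\mathrm{quo}(f,g)=P$. For $f,g\in R$ with representations $(T,\{f_i\})$, $(T,\{g_i\})$ of a common period $T$ (the least common period), $\mathrm{quo}(f,g)\in R$ is the function whose value at $n=Tm+i$ is $\mathrm{quo}(f_i,g_i)(m)$ if $g_i$ is a nonzero polynomial and $0$ if $g_i=0$. Generalized gcd: for $f,g\in R$, $g\mid f$ means that $g(n)$ divides $f(n)$ in $\mathbb{Z}$ for every $n\in\mathbb{Z}$ ($0$ divides only $0$). A greatest common divisor of $f_1,\dots,f_s\in R$ is $d\in R$ with $d\mid f_k$ for all $k$ and such that every $p\in R$ with $p\mid f_k$ for all $k$ satisfies $p\mid d$. It exists and is unique up to multiplication by a unit of $R$; $\mathrm{ggcd}(f_1,\dots,f_s)$ is the unique one with $d\succcurlyeq0$. For an ideal $I$ of $\mathbb{Z}[x]$, $\mathrm{ggcd}(I)$ is the ggcd of any finite generating set of $I$. For an $m\times l$ matrix $A(x)$ over $\mathbb{Z}[x]$ with $m\le l$ and $1\le k\le m$, let $F_k(A(x))$ be the ideal of $\mathbb{Z}[x]$ generated by all $k\times k$ minors of $A(x)$. The generalized determinantal factors are $D_k(A(x))=\mathrm{ggcd}(F_k(A(x)))$. The generalized invariant factors are $d_1(A(x))=D_1(A(x))$ and $d_k(A(x))=\mathrm{quo}(D_k(A(x)),D_{k-1}(A(x)))$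 for $2\le k\le m$. The Smith normal form $\mathrm{smith}(A(x))$ is the $m\times l$ matrix over $R$ with $(k,k)$ entry $d_k(A(x))$ for $1\le k\le m$ and all other entries $0$. *)

(* Defs.v *)
From HB Require Import structures.
From mathcomp Require Import all_boot all_order all_algebra.
From mathcomp Require Import boolp classical_sets functions.

Set Implicit Arguments.
Unset Strict Implicit.
Unset Printing Implicit Defensive.

Import Order.TTheory GRing.Theory Num.Theory.
Local Open Scope classical_set_scope.
Local Open Scope ring_scope.

Definition mx_equiv (m l : nat) (M N : 'M[int]_(m, l)) : Prop :=
  exists (U : 'M[int]_m) (V : 'M[int]_l),
    [/\ U \in unitmx, V \in unitmx & N = U *m M *m V].

(** ** The ring of integer-valued quasi-polynomials *)

Definition qp_repr (T : nat) (r : 'I_T -> {poly int}) (f : int -> int) : Prop :=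
  (0 < T)%N /\
  forall (m : int) (i : 'I_T), f (T%:Z * m + (nat_of_ord i)%:Z) = (r i).[m].

Definition is_qp : {pred int -> int} :=
  fun f => `[< exists (T : nat) (r : 'I_T -> {poly int}), qp_repr r f >].

Record quasipoly := Quasipoly { qp_fun :> int -> int ; _ : is_qp qp_fun }.

HB.instance Definition _ := [isSub for qp_fun].
HB.instance Definition _ := [Choice of quasipoly by <:].

Lemma poly_is_qp (p : {poly int}) : is_qp (fun n => p.[n]).
Proof.
apply/asboolP; exists 1%N, (fun=> p); split=> // m i.
by rewrite ord1 mul1r addr0.
Qed.

(* Passing from a representation of period T to one of period T * k. *)
Lemma qp_repr_scale (T k : nat) (r : 'I_T -> {poly int}) (f : int -> int) :
  (0 < k)%N -> qp_repr r f ->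
  exists r' : 'I_(T * k) -> {poly int}, qp_repr r' f.
Proof.
move=> k0 [T0 rf].
exists (fun i => r (Ordinal (ltn_pmod i T0)) \Po
               (k%:Z *: 'X + ((i %/ T)%N%:Z)%:P)); split.
  by rewrite muln_gt0 T0.
move=> m i; rewrite horner_comp !hornerE -rf; congr f => /=.
rewrite [in LHS](divn_eq i T) !PoszD !PoszM mulrDr mulrA addrA.
by rewrite [(Posz (_ %/ _)) * _]mulrC.
Qed.

Lemma qp_repr_common (f g : int -> int) : is_qp f -> is_qp g ->
  exists T (r s : 'I_T -> {poly int}), qp_repr r f /\ qp_repr s g.
Proof.
move=> /asboolP[T [r rf]] /asboolP[T' [s sg]].
have [T0 _] := rf; have [T'0 _] := sg.
have [r' r'f] := qp_repr_scale T'0 rf.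
have [s' s'g] := qp_repr_scale T0 sg.
by exists (T * T')%N, r'; move: s' s'g; rewrite mulnC => s' s'g; exists s'.
Qed.

Lemma is_qp_subring : subring_closed is_qp.
Proof.
split=> [|f g|f g].
- apply/asboolP; exists 1%N, (fun=> 1); split=> // m i.
  by rewrite hornerC.
- move=> /qp_repr_common h /h[T [r [s [[T0 rf] [_ sg]]]]].
  apply/asboolP; exists T, (fun i => r i - s i); split=> // m i.
  by rewrite hornerD hornerN -rf -sg.
- move=> /qp_repr_common h /h[T [r [s [[T0 rf] [_ sg]]]]].
  apply/asboolP; exists T, (fun i => r i * s i); split=> // m i.
  by rewrite hornerM -rf -sg.
Qed.

HB.instance Definition _ :=
  GRing.isSubringClosed.Build (int -> int) is_qp is_qp_subring.
HB.instance Definition _ :=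
  GRing.SubChoice_isSubComPzRing.Build (int -> int) is_qp quasipoly
    (subringClosedP is_qp).

Lemma quasipoly_oner_neq0 : (1 : quasipoly) != 0.
Proof. by apply/eqP => /(congr1 (fun f : quasipoly => f 0)). Qed.

HB.instance Definition _ :=
  GRing.PzSemiRing_isNonZero.Build quasipoly quasipoly_oner_neq0.

Definition qp_of_poly (p : {poly int}) : quasipoly := Quasipoly (poly_is_qp p).

(** ** Order *)

Definition qp_ge0 (f : quasipoly) : Prop :=
  exists (T : nat) (r : 'I_T -> {poly int}),
    qp_repr r f /\ forall i, r i = 0 \/ 0 < lead_coef (r i).

Definition qp_gt0 (f : quasipoly) : Prop :=
  exists (T : nat) (r : 'I_T -> {poly int}),
    qp_repr r f /\ forall i, r i <> 0 /\ 0 < lead_coef (r i).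

Definition qp_le (f g : quasipoly) : Prop := qp_ge0 (g - f).
Definition qp_lt (f g : quasipoly) : Prop := qp_gt0 (g - f).

Definition poly_abs (g : {poly int}) : {poly int} :=
  if `[< qp_gt0 (qp_of_poly g) >] then g
  else if `[< qp_lt (qp_of_poly g) 0 >] then - g
  else 0.

(** ** Quotient *)

Definition is_poly_quo (f g : {poly int}) (P : quasipoly) : Prop :=
  exists r : quasipoly,
    [/\ qp_of_poly f = P * qp_of_poly g + r,
        qp_le 0 r & qp_lt r (qp_of_poly (poly_abs g))].

(* For g != 0 the quotient exists and is unique; the default value 0 of [xget]
   is never used in that case. *)
Definition poly_quo (f g : {poly int}) : quasipoly :=
  xget 0 [set P | is_poly_quo f g P].

(* The third clause says that T is the least common period of f and g. *)
Definition is_quo (f g q : quasipoly) : Prop :=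
  exists (T : nat) (rf rg : 'I_T -> {poly int}),
    [/\ qp_repr rf f, qp_repr rg g,
        (forall (T' : nat) (rf' rg' : 'I_T' -> {poly int}),
           qp_repr rf' f -> qp_repr rg' g -> (T <= T')%N)
      & forall (m : int) (i : 'I_T),
          q (T%:Z * m + (nat_of_ord i)%:Z) =
          if rg i == 0 then 0 else poly_quo (rf i) (rg i) m].

(* Such a q always exists and is unique. *)
Definition quo (f g : quasipoly) : quasipoly := xget 0 [set q | is_quo f g q].

(** ** Generalized gcd *)

(* Pointwise divisibility, weaker than divisibility in the ring [quasipoly];
   note that (0 %| a)%Z holds only for a = 0. *)
Definition qp_dvd (g f : quasipoly) : Prop := forall n : int, (g n %| f n)%Z.

Definition is_gcd (fs : seq quasipoly) (d : quasipoly) : Prop :=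
  (forall f, f \in fs -> qp_dvd d f) /\
  (forall p : quasipoly, (forall f, f \in fs -> qp_dvd p f) -> qp_dvd p d).

(* Such a gcd always exists and is unique. *)
Definition ggcd (fs : seq quasipoly) : quasipoly :=
  xget 0 [set d | is_gcd fs d /\ qp_ge0 d].

Definition ideal_gen (S : set {poly int}) : set {poly int} :=
  [set p | exists cs : seq ({poly int} * {poly int}),
     (forall c, c \in cs -> S c.2) /\ p = \sum_(c <- cs) c.1 * c.2].

(* The value does not depend on the finite generating set ps of I. *)
Definition ggcd_ideal (I : set {poly int}) : quasipoly :=
  xget 0 [set d | exists ps : seq {poly int},
     I = ideal_gen [set p | p \in ps] /\ d = ggcd (map qp_of_poly ps)].

(** ** Determinantal factors, invariant factors, Smith normal form *)

Definition minors (m l k : nat) (A : 'M[{poly int}]_(m, l)) : set {poly int} :=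
  [set p | exists (f : 'I_k -> 'I_m) (g : 'I_k -> 'I_l),
     [/\ {homo f : i j / (i < j)%N}, {homo g : i j / (i < j)%N}
       & p = \det (mxsub f g A)]].

Definition det_ideal (m l : nat) (A : 'M[{poly int}]_(m, l)) (k : nat) :
  set {poly int} := ideal_gen (minors k A).

Definition det_factor (m l : nat) (A : 'M[{poly int}]_(m, l)) (k : nat) :
  quasipoly := ggcd_ideal (det_ideal A k).

Definition inv_factor (m l : nat) (A : 'M[{poly int}]_(m, l)) (k : nat) :
  quasipoly :=
  if k == 1%N then det_factor A 1 else quo (det_factor A k) (det_factor A k.-1).

(* Rows and columns are numbered from 0, hence the shift of index. *)
Definition smith (m l : nat) (A : 'M[{poly int}]_(m, l)) : 'M[quasipoly]_(m, l) :=
  \matrix_(i < m, j < l)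
    if nat_of_ord i == nat_of_ord j then inv_factor A i.+1 else 0.

Definition eval_mx (m l : nat) (A : 'M[{poly int}]_(m, l)) (n : int) :
  'M[int]_(m, l) := map_mx (horner_eval n) A.

(* Main.v *)
Require Import Defs.
From mathcomp Require Import all_boot all_order fingroup perm all_algebra.
From mathcomp Require Import boolp classical_sets.
From mathcomp Require Import zify ring.

(** Everything is read off pointwise. For integer matrices of the same shape,
    equivalence is detected by the common divisors of the minors of each size
    ([mx_equiv_of_minors_dvd]): these survive multiplication by any matrix,
    because a minor of a product is a combination of minors of each factor, so
    they are the same for equivalent matrices, and on the Smith normal form
    diag(d_0, d_1, ...) the common divisors of the k x k minors are the
    divisors of d_0 ... d_(k-1), which determine the d_i up to sign.

    It remains to see that the quasi-polynomial D_k(A) knows, at every n, the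
    gcd of the k x k minors of A(n) ([det_factorP]). The point is that the gcd
    of the values of finitely many integer polynomials is, up to sign, a
    quasi-polynomial: if d is the primitive gcd of polynomials p_i that are not
    all zero, with p_i = d q_i, then Bezout gives a nonzero integer c such that
    c d is a combination of the p_i, so the gcd of the p_i(n) is d(n) times
    gcd(c, q_1(n), ...), which is periodic in n modulo c
    ([pointwise_gcd_exists]). A common divisor among the quasi-polynomials that
    all the others divide must then agree with it up to sign, and the condition
    of being nonnegative for large n pins down the sign, since a
    quasi-polynomial that vanishes for all large n is zero ([qp_eq_abs]). Hence
    A(n) and B(n) are equivalent for all n exactly when the D_k agree.

    The D_k determine the d_k, which determine the Smith normal form, by
    definition. Conversely the diagonal of the Smith normal form lists the d_k,
    and one recovers D_(k+1) as d_(k+1) D_k. Here D_k(n) divides D_(k+1)(n) for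
    all n, and in that case the quotient is exact ([quo_exact]): if g(n)
    divides f(n) for all n, then a remainder r with 0 <= r < |g| for large n
    has g(n) | r(n), so r(n) = 0 for large n, and r = 0. *)

Set Implicit Arguments.
Unset Strict Implicit.
Unset Printing Implicit Defensive.

Import Order.TTheory GRing.Theory Num.Theory.
Local Open Scope ring_scope.

(** * Divisors of the minors of an integer matrix *)

(** Arbitrary index maps are allowed, rather than only increasing ones, so that
    the rows and columns of a minor can be manipulated freely;
    [minors_dvd_increasing] shows that this makes no difference. *)
Definition minors_dvd (t : int) (k m l : nat) (M : 'M[int]_(m, l)) : Prop :=
  forall (f : 'I_k -> 'I_m) (g : 'I_k -> 'I_l), (t %| \det (mxsub f g M))%Z.

(** The increasing map lists the image of f in order. *)
Lemma injective_increasing_perm (k m : nat) (f : 'I_k -> 'I_m) : injective f ->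
  exists (s : 'S_k) (f' : 'I_k -> 'I_m),
    {homo f' : i j / (i < j)%N} /\ f =1 f' \o s.
Proof.
move=> f_inj; pose X := [set f i | i : 'I_k].
have cX : k = #|X| by rewrite card_imset // card_ord.
have fX i : f i \in X by exact: imset_f.
pose f' (i : 'I_k) : 'I_m := Order.enum_val (cast_ord cX i).
pose s0 (i : 'I_k) : 'I_k :=
  cast_ord (esym cX) (Order.enum_rank_in (fX i) (f i)).
have fE i : f i = f' (s0 i).
  by rewrite /f' /s0 cast_ordKV Order.enum_rankK_in.
have s0_inj : injective s0 by move=> i j e; apply: f_inj; rewrite !fE e.
exists (perm s0_inj), f'; split=> [i j ij | i]; last by rewrite /= permE fE.
have := leW_mono (Order.le_enum_val (@le_total _ _) (A := mem X))
  (cast_ord cX i) (cast_ord cX j).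
by rewrite !ltEord /= ij => ->.
Qed.

(** A minor with a repeated row or column vanishes, and any other one is, up to
    sign, a minor with increasing indices. *)
Lemma minors_dvd_increasing (t : int) (k m l : nat) (M : 'M[int]_(m, l)) :
  (forall (f : 'I_k -> 'I_m) (g : 'I_k -> 'I_l),
     {homo f : i j / (i < j)%N} -> {homo g : i j / (i < j)%N} ->
     (t %| \det (mxsub f g M))%Z) ->
  minors_dvd t k M.
Proof.
move=> incr f g.
have [f_inj|] := boolP (injectiveb f); last first.
  case/injectivePn=> i [j ij fij]; rewrite (determinant_alternate ij) ?dvdz0 //.
  by move=> h; rewrite !mxE fij.
have [g_inj|] := boolP (injectiveb g); last first.
  case/injectivePn=> i [j ij gij]; rewrite -det_tr.
  by rewrite (determinant_alternate ij) ?dvdz0 // => h; rewrite !mxE gij.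
have [s [f' [f'_incr fE]]] := injective_increasing_perm (injectiveP _ f_inj).
have [u [g' [g'_incr gE]]] := injective_increasing_perm (injectiveP _ g_inj).
have -> : mxsub f g M = row_perm s (col_perm u (mxsub f' g' M)).
  by apply/matrixP=> i j; rewrite !mxE fE gE.
rewrite row_permE col_permE !det_mulmx !det_perm.
by rewrite dvdz_mull // dvdz_mulr // incr.
Qed.

(** Each row of P *m Q is a combination of the rows of Q, so this is the
    multilinearity of the determinant. It is the Cauchy-Binet formula before
    the terms with the same set of rows are grouped together. *)
Lemma det_mulmx_rowsub (R : comPzRingType) (k m : nat)
    (P : 'M[R]_(k, m)) (Q : 'M[R]_(m, k)) :
  \det (P *m Q) =
  \sum_(h : {ffun 'I_k -> 'I_m}) (\prod_i P i (h i)) * \det (rowsub h Q).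
Proof.
pose PQ (s : 'S_k) i j := P i j * Q j (s i).
transitivity (\sum_(h : {ffun 'I_k -> 'I_m}) \sum_(s : 'S_k)
                (-1) ^+ s * \prod_i PQ s i (h i)).
  rewrite exchange_big; apply: eq_bigr => /= s _; rewrite -big_distrr /=.
  congr (_ * _); rewrite -(bigA_distr_bigA (PQ s)) /=.
  by apply: eq_bigr => i _; rewrite mxE.
apply: eq_bigr => h _; rewrite big_distrr /=; apply: eq_bigr => s _.
rewrite mulrCA big_split //=; congr (_ * (_ * _)).
by apply: eq_bigr => i _; rewrite mxE.
Qed.

Lemma minors_dvd_mull (t : int) (k m n l : nat)
    (U : 'M[int]_(m, n)) (M : 'M[int]_(n, l)) :
  minors_dvd t k M -> minors_dvd t k (U *m M).
Proof.
move=> tM f g; rewrite mxsub_mul det_mulmx_rowsub.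
apply: rpred_sum => h _; rewrite dvdz_mull //.
have -> : rowsub h (colsub g M) = mxsub h g M.
  by apply/matrixP=> i j; rewrite !mxE.
exact: tM.
Qed.

Lemma minors_dvd_tr (t : int) (k m l : nat) (M : 'M[int]_(m, l)) :
  minors_dvd t k M -> minors_dvd t k M^T.
Proof.
move=> tM f g; rewrite -det_tr; have := tM g f; congr (is_true (_ %| \det _)%Z).
by apply/matrixP=> i j; rewrite !mxE.
Qed.

Lemma minors_dvd_mulr (t : int) (k m n l : nat)
    (M : 'M[int]_(m, n)) (V : 'M[int]_(n, l)) :
  minors_dvd t k M -> minors_dvd t k (M *m V).
Proof.
move=> tM; rewrite -[M *m V]trmxK trmx_mul.
by apply/minors_dvd_tr/minors_dvd_mull/minors_dvd_tr.
Qed.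

Lemma mx_equiv_sym (m l : nat) (M N : 'M[int]_(m, l)) :
  mx_equiv M N -> mx_equiv N M.
Proof.
case=> U [V [Uu Vu ->]]; exists (invmx U), (invmx V).
by rewrite !unitmx_inv Uu Vu !mulmxA mulVmx // mul1mx -mulmxA mulmxV ?mulmx1.
Qed.

Lemma mx_equiv_trans (m l : nat) (M N P : 'M[int]_(m, l)) :
  mx_equiv M N -> mx_equiv N P -> mx_equiv M P.
Proof.
case=> U [V [Uu Vu ->]] [U' [V' [Uu' Vu' ->]]]; exists (U' *m U), (V *m V').
by rewrite !unitmx_mul Uu Vu Uu' Vu' !mulmxA.
Qed.

Lemma mx_equiv_minors_dvd (t : int) (k m l : nat) (M N : 'M[int]_(m, l)) :
  mx_equiv M N -> minors_dvd t k M <-> minors_dvd t k N.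
Proof.
have imp (M' N' : 'M[int]_(m, l)) :
    mx_equiv M' N' -> minors_dvd t k M' -> minors_dvd t k N'.
  by case=> U [V [_ _ ->]] tM; apply/minors_dvd_mulr/minors_dvd_mull.
by move=> MN; split; apply: imp => //; exact: mx_equiv_sym.
Qed.

(** * Integer matrices are classified by the divisors of their minors *)

Definition diag_seq (m l : nat) (d : seq int) : 'M[int]_(m, l) :=
  \matrix_(i, j) (d`_i *+ (i == j :> nat)).

Lemma sorted_dvdz_nth (d : seq int) (i j : nat) :
  sorted dvdz d -> (i <= j)%N -> (d`_i %| d`_j)%Z.
Proof.
move=> sd ij; have [jd|dj] := ltnP j (size d); last first.
  by rewrite (nth_default _ dj) dvdz0.
have dvdz_tr : transitive dvdz by move=> y x z; exact: dvdz_trans.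
by apply: (sorted_leq_nth dvdz_tr dvdzz 0 sd) => //; exact: leq_ltn_trans jd.
Qed.

Lemma homo_ltn_ge (k m : nat) (f : 'I_k -> 'I_m) (i : 'I_k) :
  {homo f : i j / (i < j)%N} -> (i <= f i)%N.
Proof.
move=> f_incr; case: i => i; elim: i => // i IH ik /=.
by apply: leq_ltn_trans (IH (ltnW ik)) (f_incr _ _ _).
Qed.

(** The leading minor is the product of the first k diagonal entries. It
    divides all the others: a nonzero term of such a minor is the product of
    the entries d_(f i) for an increasing f, and i <= f i. *)
Lemma minors_dvd_diag (t : int) (k m l : nat) (d : seq int) :
  sorted dvdz d -> (k <= m)%N -> (k <= l)%N ->
  minors_dvd t k (diag_seq m l d) <-> (t %| \prod_(i < k) d`_i)%Z.
Proof.
move=> sd km kl; split=> [tD | td].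
  have := tD (widen_ord km) (widen_ord kl).
  congr (is_true (_ %| _)%Z).
  have -> : mxsub (widen_ord km) (widen_ord kl) (diag_seq m l d)
            = diag_mx (\row_i d`_i).
    by apply/matrixP=> i j; rewrite !mxE.
  by rewrite det_diag; apply: eq_bigr => i _; rewrite mxE.
apply: minors_dvd_increasing => f g f_incr _.
apply: rpred_sum => s _; apply: dvdz_mull; apply: dvdz_trans td _.
elim/big_ind2: _ => // [x1 x2 y1 y2|i _]; first exact: dvdz_mul.
rewrite !mxE; case: (_ == _); last by rewrite mulr0n dvdz0.
exact: sorted_dvdz_nth (homo_ltn_ge _ f_incr).
Qed.

Lemma mx_equiv_diag (m l : nat) (M : 'M[int]_(m, l)) :
  exists2 d : seq int, sorted dvdz d & mx_equiv (diag_seq m l d) M.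
Proof.
have [L Lu [R Ru [d sd ->]]] := int_Smith_normal_form M.
by exists d => //; exists L, R.
Qed.

(** On the diagonal form, the products of diagonal entries divide each other. *)
Lemma minors_dvdS (t : int) (k m l : nat) (M : 'M[int]_(m, l)) :
  (k < m)%N -> (k < l)%N -> minors_dvd t k M -> minors_dvd t k.+1 M.
Proof.
move=> km kl; have [d sd dM] := mx_equiv_diag M.
rewrite -!(mx_equiv_minors_dvd _ _ dM) !minors_dvd_diag //; try exact: ltnW.
by rewrite big_ord_recr => td; rewrite dvdz_mulr.
Qed.

Lemma absz_eq_dvdz (x y : int) :
  (forall t, (t %| x)%Z <-> (t %| y)%Z) -> `|x|%N = `|y|%N.
Proof.
by move=> xy; apply/eqP; rewrite eqn_dvd; apply/andP; split; apply/xy/dvdzz.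
Qed.

(** Cancellation in the products gives the entry of index i, unless the product
    of the previous ones is zero; then one of these is zero, and 0 divides the
    entry of index i in both sequences. *)
Lemma diag_absz_eq (k : nat) (d e : seq int) :
  sorted dvdz d -> sorted dvdz e ->
  (forall j, (0 < j <= k)%N ->
     `|(\prod_(i < j) d`_i)%R|%N = `|(\prod_(i < j) e`_i)%R|%N) ->
  forall i, (i < k)%N -> `|(d`_i)%R|%N = `|(e`_i)%R|%N.
Proof.
move=> sd se de i ik.
have pE j : (j <= k)%N ->
    `|(\prod_(i < j) d`_i)%R|%N = `|(\prod_(i < j) e`_i)%R|%N.
  by case: j => [|j] jk; [rewrite !big_ord0 | apply: de].
have zero (d' : seq int) : sorted dvdz d' ->
    `|(\prod_(j < i) d'`_j)%R|%N == 0%N -> d'`_i = 0.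
  move=> sd'; rewrite absz_eq0 => /prodf_eq0[j _ /eqP d'j].
  by have := sorted_dvdz_nth sd' (ltnW (ltn_ord j)); rewrite d'j dvd0z => /eqP.
have [d0|d_neq0] := boolP (`|(\prod_(j < i) d`_j)%R|%N == 0%N).
  rewrite (zero d) // (zero e) //.
  by rewrite -pE // ltnW.
have := pE _ ik; rewrite !big_ord_recr !abszM -(pE i (ltnW ik)) => /eqP.
by rewrite eqn_pmul2l ?lt0n // => /eqP.
Qed.

(** A diagonal matrix of signs relates the two. *)
Lemma diag_seq_equiv (m l : nat) (d e : seq int) :
  (forall i, (i < m)%N -> `|(d`_i)%R|%N = `|(e`_i)%R|%N) ->
  mx_equiv (diag_seq m l d) (diag_seq m l e).
Proof.
move=> de; pose u : 'rV[int]_m := \row_i ((-1) ^+ ((d`_i < 0) (+) (e`_i < 0))).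
exists (diag_mx u), 1%:M; split; [|exact: unitmx1|].
  rewrite unitmxE det_diag; apply: rpred_prod => i _.
  by rewrite mxE unitrX ?unitrN1.
apply/matrixP=> i j; rewrite mulmx1 mul_diag_mx !mxE mulrnAr; congr (_ *+ _).
rewrite signr_addb -mulrA mulrCA [in LHS](intEsign e`_i) -(de i (ltn_ord i)).
by rewrite [d`_i in X in _ * (_ * X)]intEsign signrMK.
Qed.

Lemma mx_equiv_of_minors_dvd (m l : nat) (M N : 'M[int]_(m, l)) :
  (m <= l)%N ->
  (forall k t, (0 < k <= m)%N -> minors_dvd t k M <-> minors_dvd t k N) ->
  mx_equiv M N.
Proof.
move=> ml MN.
have [d sd dM] := mx_equiv_diag M; have [e se eN] := mx_equiv_diag N.
apply: (mx_equiv_trans (mx_equiv_sym dM)); apply: (mx_equiv_trans _ eN).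
apply/diag_seq_equiv/diag_absz_eq => // k km; apply: absz_eq_dvdz => t.
have [_ km'] := andP km; have kl := leq_trans km' ml.
rewrite -(minors_dvd_diag t sd km' kl) -(minors_dvd_diag t se km' kl).
by rewrite (mx_equiv_minors_dvd t k dM) (mx_equiv_minors_dvd t k eN); exact: MN.
Qed.

(** * Behaviour of polynomials and quasi-polynomials at large integers *)

Definition eventually (P : int -> Prop) : Prop :=
  exists N : int, forall n, N <= n -> P n.

Lemma eventually_mp (P Q : int -> Prop) :
  (forall n, P n -> Q n) -> eventually P -> eventually Q.
Proof. by move=> PQ [N PN]; exists N => n /PN /PQ. Qed.

Lemma eventually_and (P Q : int -> Prop) :
  eventually P -> eventually Q -> eventually (fun n => P n /\ Q n).
Proof.
move=> [N PN] [N' QN']; exists (Num.max N N') => n.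
by rewrite ge_max => /andP[/PN ? /QN' ?].
Qed.

Lemma int_classP (T : nat) (n : int) : (0 < T)%N ->
  exists (m : int) (i : 'I_T), n = T%:Z * m + (nat_of_ord i)%:Z.
Proof.
move=> T0; have Tn0 : T%:Z != 0 by lia.
have n0 := modz_ge0 n Tn0; have nT := ltz_pmod n (_ : 0 < T%:Z).
have iT : (`|(n %% T)%Z|%N < T)%N by move: (nT T0) n0; lia.
exists (n %/ T)%Z, (Ordinal iT) => /=.
by rewrite gez0_abs // mulrC -divz_eq.
Qed.

Lemma eventually_classes (T : nat) (P : int -> Prop) : (0 < T)%N ->
  (forall i : 'I_T, eventually (fun m => P (T%:Z * m + (nat_of_ord i)%:Z))) ->
  eventually P.
Proof.
move=> T0 /choice[N_ PN].
(* Since i < T, the bound T * (1 + S) <= T * m + i forces S <= m. *)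
exists (T%:Z * (1 + \sum_i `|N_ i|)) => n.
have [m [i ->]] := int_classP n T0 => le_n; apply: PN.
have iT : (i < T)%N := ltn_ord i.
have : `|N_ i| <= \sum_i `|N_ i|.
  by rewrite (bigD1 i) //= lerDl sumr_ge0.
move: le_n; set S := \sum_i _; move=> le_n leS.
have : S <= m by nia.
by move: leS; lia.
Qed.

Lemma eventually_class (T : nat) (P : int -> Prop) (i : nat) : (0 < T)%N ->
  eventually P -> eventually (fun m => P (T%:Z * m + i%:Z)).
Proof.
move=> T0 [N PN]; exists `|N| => m le_m; apply: PN.
by nia.
Qed.

Lemma poly_eventually_gt0 (p : {poly int}) :
  0 < lead_coef p -> eventually (fun n => 0 < p.[n]).
Proof.
elim/poly_ind: p => [|p c IH]; first by rewrite lead_coef0.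
have [->|p0] := eqVneq p 0.
  rewrite mul0r add0r lead_coefC => c0; exists 0 => n _.
  by rewrite hornerC.
have -> : lead_coef (p * 'X + c%:P) = lead_coef p.
  rewrite lead_coefDl ?lead_coefMX // size_mulX //.
  by rewrite (leq_ltn_trans (size_polyC_leq1 c)) // ltnS size_poly_gt0.
move=> /IH[N pN]; exists (Num.max N (1 + `|c|)) => n.
rewrite ge_max => /andP[/pN pn cn]; rewrite hornerMXaddC.
by nia.
Qed.

Lemma qp_gt0_eventually (f : quasipoly) :
  qp_gt0 f -> eventually (fun n => 0 < f n).
Proof.
case=> T [r [[T0 rf] r_gt0]]; apply: (eventually_classes T0) => i.
have [_ /poly_eventually_gt0] := r_gt0 i.
by apply: eventually_mp => m; rewrite rf.
Qed.

Lemma qp_ge0_eventually (f : quasipoly) :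
  qp_ge0 f -> eventually (fun n => 0 <= f n).
Proof.
case=> T [r [[T0 rf] r_ge0]]; apply: (eventually_classes T0) => i.
case: (r_ge0 i) => [ri0|/poly_eventually_gt0].
  by exists 0 => m _; rewrite rf ri0 horner0.
by apply: eventually_mp => m; rewrite rf => /ltW.
Qed.

Lemma lead_coef_sign (p : {poly int}) :
  [\/ p = 0, 0 < lead_coef p | 0 < lead_coef (- p)].
Proof.
rewrite lead_coefN oppr_gt0; have [p0|p0|/esym/eqP] := ltgtP 0 (lead_coef p).
- by constructor 2.
- by constructor 3.
- by rewrite lead_coef_eq0 => /eqP; constructor 1.
Qed.

Lemma poly_eventually_neq0 (p : {poly int}) :
  p != 0 -> eventually (fun n => p.[n] != 0).
Proof.
move=> /eqP p0; case: (lead_coef_sign p) => // /poly_eventually_gt0;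
  apply: eventually_mp => n; rewrite ?hornerN ?oppr_gt0.
- exact: lt0r_neq0.
- exact: ltr0_neq0.
Qed.

(** On each residue class the function is a polynomial with infinitely many
    zeros. *)
Lemma qp_eventually0 (f : quasipoly) :
  eventually (fun n => f n = 0) -> forall n, f n = 0.
Proof.
move=> f0 n; have /asboolP[T [r [T0 rf]]] := valP f.
have [m [i ->]] := int_classP n T0; rewrite rf.
have [->|/poly_eventually_neq0 ri0] := eqVneq (r i) 0; first exact: horner0.
have [N h] := eventually_and (eventually_class i T0 f0) ri0.
by have [] := h N (lexx N); rewrite rf => ->.
Qed.

(** * Constructions of quasi-polynomials *)

Lemma qp_sumE (I : finType) (F : I -> quasipoly) (n : int) :
  (\sum_i F i) n = \sum_i F i n.
Proof. by elim/big_rec2: _ => [//|i x y _ <-]. Qed.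

Lemma qp_periodic (T : nat) (u : int -> int) : (0 < T)%N ->
  (forall n, u n = u (n %% T)%Z) -> is_qp u.
Proof.
move=> T0 uT; apply/asboolP; exists T, (fun i => (u i)%:P); split=> // m i.
by rewrite hornerC uT mulrC modzMDl modz_small //= ltz_nat ltn_ord.
Qed.

Lemma qp_dilate (T : nat) (h : quasipoly) : (0 < T)%N ->
  is_qp (fun n => h (n %/ T)%Z).
Proof.
move=> T0; have /asboolP[T' [r [T'0 rh]]] := valP h.
have jT' (k : 'I_(T * T')) : (k %/ T < T')%N.
  by rewrite ltn_divLR // [X in (_ < X)%N]mulnC ltn_ord.
apply/asboolP; exists (T * T')%N, (fun k => r (Ordinal (jT' k))); split.
  by rewrite muln_gt0 T0.
move=> m k; rewrite -rh /= PoszM -mulrA mulrC divzMDl; last by lia.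
by rewrite divz_nat.
Qed.

(** Quasi-polynomials can be prescribed independently on each residue class.
    Writing the result as a sum over the classes of products with indicator
    functions leaves it to the ring structure to find a common period. *)
Lemma qp_glue (T : nat) (h : 'I_T -> quasipoly) : (0 < T)%N ->
  exists f : quasipoly,
    forall (m : int) (i : 'I_T), f (T%:Z * m + (nat_of_ord i)%:Z) = h i m.
Proof.
move=> T0.
have ind_qp (i : 'I_T) : is_qp (fun n => ((n %% T)%Z == i)%:R).
  by apply: (qp_periodic T0) => n; rewrite modz_mod.
exists (\sum_i Quasipoly (ind_qp i) * Quasipoly (qp_dilate (h i) T0)) => m i.
have mE (j : 'I_T) : ((T%:Z * m + (nat_of_ord i)%:Z) %% T)%Z == j = (j == i).
  by rewrite mulrC modzMDl modz_small ?ltz_nat ?ltn_ord //= eqz_nat eq_sym.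
rewrite qp_sumE (bigD1 i) //= big1 => [|j ji].
  rewrite addr0 /= -[LHS]/(_ * _) /= mE eqxx mul1r mulrC divzMDl; last by lia.
  by rewrite divz_small ?addr0 // ltz_nat ltn_ord.
by rewrite -[LHS]/(_ * _) /= mE (negPf ji) mul0r.
Qed.

Lemma horner_class (p : {poly int}) (c j : int) :
  exists s : {poly int}, forall m, p.[c * m + j] = p.[j] + c * s.[m].
Proof.
elim/poly_ind: p => [|p a [s sE]].
  by exists 0 => m; rewrite !horner0 mulr0.
exists (p.[j] *: 'X + s * (c *: 'X + j%:P)) => m.
by rewrite !hornerE sE; ring.
Qed.

(** The values of p at n and at n modulo c differ by a multiple of c. *)
Lemma dvdz_mul_horner_modz (p : {poly int}) (t x c n : int) :
  (t %| x * c)%Z -> (t %| x * p.[n])%Z = (t %| x * p.[(n %% c)%Z])%Z.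
Proof.
move=> txc; have [s sE] := horner_class p c (n %% c)%Z.
rewrite {1}(divz_eq n c) [_ * c]mulrC sE mulrDr mulrA rpredDr //.
exact: dvdz_mulr.
Qed.

(** With n = |c| m + i, the value of p at n is a polynomial in m with all
    nonconstant coefficients divisible by c, so the floor only acts on the
    constant term. *)
Lemma qp_divz (p : {poly int}) (c : int) : c != 0 ->
  is_qp (fun n => (p.[n] %/ c)%Z).
Proof.
move=> c0; have /choice[s sE] : forall i : 'I_`|c|,
    exists s : {poly int}, forall m,
      p.[`|c|%N%:Z * m + (nat_of_ord i)%:Z] = p.[i] + `|c|%N%:Z * s.[m].
  by move=> i; exact: horner_class.
apply/asboolP; exists `|c|%N, (fun i => sgz c *: s i + (p.[i] %/ c)%Z%:P).
split; first by rewrite absz_gt0.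
move=> m i; rewrite sE !hornerE.
have -> : p.[i] + `|c|%N%:Z * (s i).[m] = (sgz c * (s i).[m]) * c + p.[i].
  by rewrite abszEsg; ring.
by rewrite divzMDl.
Qed.

(** The sign is chosen on each residue class, which makes the nonzero leading
    coefficients positive. *)
Lemma qp_abs (f : quasipoly) :
  exists2 g : quasipoly, qp_ge0 g & forall n, `|g n|%N = `|f n|%N.
Proof.
have /asboolP[T [r [T0 rf]]] := valP f.
pose s i := if 0 < lead_coef (r i) then r i else - r i.
have [g gE] := qp_glue (fun i => qp_of_poly (s i)) T0.
exists g => [|n].
  exists T, s; split=> [//|i]; rewrite /s.
  case: (lead_coef_sign (r i)) => [->|h|h].
  - by rewrite lead_coef0 ltxx oppr0; left.
  - by right; rewrite h.
  - by right; case: ifP.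
have [m [i ->]] := int_classP n T0; rewrite gE rf /= /s.
by case: ifP => _; rewrite ?hornerN ?abszN.
Qed.

(** * The generalized gcd is a pointwise gcd *)

Lemma ideal_gen_sub (S : set {poly int}) (p : {poly int}) :
  S p -> ideal_gen S p.
Proof.
move=> Sp; exists [:: (1, p)]; rewrite big_seq1 mul1r; split=> // c.
by rewrite inE => /eqP ->.
Qed.

Lemma ideal_gen_dvdz (S : set {poly int}) (t n : int) (q : {poly int}) :
  (forall p, S p -> (t %| p.[n])%Z) -> ideal_gen S q -> (t %| q.[n])%Z.
Proof.
move=> tS [cs [csS ->]]; rewrite horner_sum big_seq.
by apply: rpred_sum => c /csS /tS tc; rewrite hornerM dvdz_mull.
Qed.

(** A Bezout combination g of the ps. The polynomials of ps are divisible by g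
    only over the rationals, as pseudo-division allows, while the second clause
    is what is needed of g being in the ideal of Z[x] generated by ps. *)
Lemma poly_common_divisor (ps : seq {poly int}) :
  exists g : {poly int},
    (forall p, p \in ps -> g %| p) /\
    (forall t n, (forall p, p \in ps -> (t %| p.[n])%Z) -> (t %| g.[n])%Z).
Proof.
elim: ps => [|p ps [g [g_dvd g_comb]]].
  by exists 0; split=> // t n _; rewrite horner0 dvdz0.
have [[u v] /= uvE] := Pdiv.Idomain.Bezoutp p g.
exists (u * p + v * g); split=> [q|t n tps].
  rewrite (Pdiv.Idomain.eqp_dvdl _ uvE) inE => /predU1P[->|/g_dvd].
    exact: Pdiv.Idomain.dvdp_gcdl.
  by apply: Pdiv.Idomain.dvdp_trans; exact: Pdiv.Idomain.dvdp_gcdr.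
have tg : (t %| g.[n])%Z.
  by apply: g_comb => q qps; rewrite tps // inE qps orbT.
by rewrite hornerD !hornerM rpredD // dvdz_mull // tps ?mem_head.
Qed.

Lemma dvdz_mul_foldr_gcdz (t x c : int) (vs : seq int) :
  (t %| x * foldr gcdz c vs)%Z =
  (t %| x * c)%Z && all (fun v => (t %| x * v)%Z) vs.
Proof.
elim: vs => [|v vs IH] /=; first by rewrite andbT.
rewrite andbCA -IH -dvdz_gcd -mulz_gcdr.
by rewrite !dvdzE !abszM.
Qed.

(** Describing a gcd by its divisors avoids any choice of sign. *)
Definition pointwise_gcd (d : quasipoly) (ps : seq {poly int}) : Prop :=
  forall n t, (t %| d n)%Z <-> forall p, p \in ps -> (t %| p.[n])%Z.

(** With g the Bezout combination above, d its primitive part and c its content,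
    each p is d * q p by Gauss's lemma. A common divisor of the values p.[n]
    divides g.[n] = d.[n] * c, so the gcd of these values is d.[n] times the
    gcd h n of c and the (q p).[n], which only depends on n modulo c. *)
Lemma pointwise_gcd_exists (ps : seq {poly int}) :
  exists2 d, qp_ge0 d & pointwise_gcd d ps.
Proof.
suff [d dps] : exists d, pointwise_gcd d ps.
  have [d' d'0 d'd] := qp_abs d; exists d' => // n t.
  by rewrite -dps !dvdzE d'd.
have [g [g_dvd g_comb]] := poly_common_divisor ps.
have [g0|g_neq0] := eqVneq g 0.
  exists 0 => n t; split=> [_ p /g_dvd|_]; last exact: dvdz0.
  by rewrite g0 Pdiv.Idomain.dvd0p => /eqP->; rewrite horner0 dvdz0.
pose c := zcontents g; pose d := zprimitive g.
have gE n : g.[n] = d.[n] * c by rewrite {1}[g]zpolyEprim hornerZ mulrC.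
have /choice[q qE] : forall p, exists q, p \in ps -> p = d * q.
  move=> p; have [/g_dvd/dvdpP_int[q ->]|] := boolP (p \in ps).
    by exists q.
  by exists 0.
pose h n := foldr gcdz c [seq (q p).[(n %% c)%Z] | p <- ps].
have h_qp : is_qp h.
  apply: (@qp_periodic `|c|) => [|n]; first by rewrite absz_gt0 zcontents_eq0.
  by rewrite /h modz_abs modz_mod.
exists (qp_of_poly d * Quasipoly h_qp) => n t.
rewrite -[X in (_ %| X)%Z]/(d.[n] * h n) dvdz_mul_foldr_gcdz -gE all_map.
have pE p : (t %| g.[n])%Z -> p \in ps ->
    (t %| p.[n])%Z = (t %| d.[n] * (q p).[(n %% c)%Z])%Z.
  move=> tg /qE {1}->; rewrite hornerM.
  by apply: dvdz_mul_horner_modz; rewrite -gE.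
split=> [/andP[tg /allP tq] p pps|tps]; first by rewrite pE //; exact: tq.
have tg := g_comb _ _ tps.
by rewrite tg; apply/allP => p pps /=; rewrite -pE // tps.
Qed.

(** Both functions are nonnegative for large n, hence equal there. *)
Lemma qp_eq_abs (d d' : quasipoly) : qp_ge0 d -> qp_ge0 d' ->
  (forall n, `|d n|%N = `|d' n|%N) -> d = d'.
Proof.
move=> d0 d'0 dd'; apply/val_inj/funext => n; apply/eqP; rewrite -subr_eq0.
apply/eqP; apply: (@qp_eventually0 (d - d')).
have := eventually_and (qp_ge0_eventually d0) (qp_ge0_eventually d'0).
apply: eventually_mp.
move=> k [dk d'k]; rewrite -[LHS]/(d k - d' k).
by rewrite -[d k](gez0_abs dk) -[d' k](gez0_abs d'k) dd' subrr.
Qed.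

(** The gcd of quasi-polynomials is only maximal among the common divisors that
    are quasi-polynomials. It is the gcd at each point because the pointwise
    gcd is one of them. *)
Lemma ggcdP (ps : seq {poly int}) (d := ggcd (map qp_of_poly ps)) :
  qp_ge0 d /\ pointwise_gcd d ps.
Proof.
have [e e0 eps] := pointwise_gcd_exists ps.
have e_dvd f : f \in map qp_of_poly ps -> qp_dvd e f.
  by case/mapP=> p pps -> n; apply: (iffLR (eps n _)) pps.
have e_gcd : is_gcd (map qp_of_poly ps) e.
  split=> // f fps n; apply/eps => p pps.
  exact: (fps _ (map_f qp_of_poly pps)).
have [[d_dvd d_gcd] d0] : is_gcd (map qp_of_poly ps) d /\ qp_ge0 d.
  by apply: (xgetPex (P := fun f => is_gcd _ f /\ qp_ge0 f) 0); exists e.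
split=> // n t; split=> [td p pps|tps].
  exact: dvdz_trans td (d_dvd _ (map_f qp_of_poly pps) n).
by apply: dvdz_trans (d_gcd _ e_dvd n); apply/eps.
Qed.

(** The description does not mention the generators qs chosen for the ideal of
    minors: the common divisors of the values at n of a generating set are those
    of the values of all members of the ideal. *)
Lemma det_factorP (m l k : nat) (A : 'M[{poly int}]_(m, l)) :
  qp_ge0 (det_factor A k) /\
  forall n t, (t %| det_factor A k n)%Z <-> minors_dvd t k (eval_mx A n).
Proof.
pose FG := ({ffun 'I_k -> 'I_m} * {ffun 'I_k -> 'I_l})%type.
pose is_incr (fg : FG) :=
  `[< {homo fg.1 : i j / (i < j)%N} /\ {homo fg.2 : i j / (i < j)%N} >].
pose ps := [seq \det (mxsub fg.1 fg.2 A) | fg : FG <- enum is_incr].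
have psE : minors k A = [set p | p \in ps]%classic.
  apply/seteqP; split=> [p [f [g [fi gi ->]]]|p /mapP[fg]].
    apply/mapP; exists (finfun f, finfun g); last by rewrite mxsub_ffun.
    by rewrite mem_enum; apply/asboolP; split=> i j ij /=; rewrite !ffunE; auto.
  by rewrite mem_enum => /asboolP[fi gi] ->; exists fg.1, fg.2.
have [qs [qsE ->]] : exists qs : seq {poly int},
    det_ideal A k = ideal_gen [set p | p \in qs]%classic /\
    det_factor A k = ggcd (map qp_of_poly qs).
  apply: (xgetPex (P := fun d => exists qs, _ = _ /\ d = _) 0).
  by exists (ggcd (map qp_of_poly ps)), ps; rewrite /det_ideal psE.
have [d0 dE] := ggcdP qs; split=> // n t; rewrite dE.
have evE (f : 'I_k -> 'I_m) (g : 'I_k -> 'I_l) :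
    \det (mxsub f g (eval_mx A n)) = (\det (mxsub f g A)).[n].
  by rewrite /eval_mx -map_mxsub det_map_mx.
split=> [tqs|tA q qqs].
  apply: minors_dvd_increasing => f g fi gi; rewrite evE.
  apply: (@ideal_gen_dvdz _ t n _ tqs); rewrite -[X in X _]qsE.
  by apply: ideal_gen_sub; exists f, g.
apply: (@ideal_gen_dvdz (minors k A)) => [p [f [g [_ _ ->]]]|].
  by rewrite -evE.
by rewrite -[ideal_gen _]/(det_ideal A k) qsE; apply: ideal_gen_sub.
Qed.

(** * Exactness of the quotient *)

Lemma poly_gt0_qp (p : {poly int}) (f : quasipoly) :
  (forall n, f n = p.[n]) -> 0 < lead_coef p -> qp_gt0 f.
Proof.
move=> fp p0; exists 1%N, (fun=> p); split; last first.
  by move=> _; split=> // /eqP; rewrite -lead_coef_eq0 gt_eqF.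
by split=> // m i; rewrite ord1 mul1r addr0.
Qed.

Lemma poly_absP (g : {poly int}) : g != 0 ->
  0 < lead_coef (poly_abs g) /\ (poly_abs g = g \/ poly_abs g = - g).
Proof.
move=> g0; rewrite /poly_abs.
have [//|g_gt0|g_lt0] := lead_coef_sign g; first by move/eqP: g0.
  by rewrite asboolT; [split; [|left] | exact: poly_gt0_qp g_gt0].
rewrite asboolF => [|/qp_gt0_eventually g1]; last first.
  have [N /(_ N (lexx N))] := eventually_and g1 (poly_eventually_gt0 g_lt0).
  by rewrite hornerN oppr_gt0 => -[/= g2 /(lt_trans g2)]; rewrite ltxx.
rewrite asboolT; first by split; [|right].
by apply: poly_gt0_qp g_lt0 => n; rewrite hornerN -[LHS]/(0 - g.[n]) sub0r.
Qed.

Lemma abs_horner_poly_abs (g : {poly int}) (n : int) : g != 0 ->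
  `|(poly_abs g).[n]| = `|g.[n]|.
Proof. by case/poly_absP=> _ [] ->; rewrite ?hornerN ?normrN. Qed.

Lemma dvdz_small (a b : int) : (a %| b)%Z -> `|b| < `|a| -> b = 0.
Proof.
move=> /dvdzP[q ->]; rewrite normrM => lt; have -> : q = 0 by nia.
by rewrite mul0r.
Qed.

(** The pseudo-remainder of f by g has degree less than g, so its values, which
    are multiples of those of g, are smaller for large n and hence zero. *)
Lemma dvdz_horner_dvdp (f g : {poly int}) : g != 0 ->
  (forall n, (g.[n] %| f.[n])%Z) -> g %| f.
Proof.
move=> g0 gf; have [G_gt0 G_g] := poly_absP g0.
have := Pdiv.Idomain.divp_eq f g; have := Pdiv.Idomain.ltn_modpN0 f g0.
rewrite /Pdiv.Idomain.dvdp; set r := (f %% g); set q := f %/ g.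
set c := _ ^+ _ => r_lt fE.
have gr n : (g.[n] %| r.[n])%Z.
  have -> : r.[n] = c * f.[n] - q.[n] * g.[n].
    by rewrite -hornerZ fE hornerD hornerM addrAC subrr add0r.
  by rewrite rpredB // dvdz_mull.
have rG : (size r < size (poly_abs g))%N.
  by case: G_g => ->; rewrite ?size_polyN.
have Gr_gt0 : 0 < lead_coef (poly_abs g + r) by rewrite lead_coefDl.
have Gmr_gt0 : 0 < lead_coef (poly_abs g - r).
  by rewrite lead_coefDl ?size_polyN.
have [//|/poly_eventually_neq0 r_neq0] := eqVneq r 0.
have [N /(_ N (lexx N))[]] := eventually_and r_neq0 (eventually_and
  (poly_eventually_gt0 Gr_gt0) (poly_eventually_gt0 Gmr_gt0)).
move=> /eqP rN [Gr Gmr]; case: rN; apply: dvdz_small (gr N) _.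
rewrite -(abs_horner_poly_abs _ g0); apply: lt_le_trans (ler_norm _).
move: Gr Gmr; rewrite !hornerD hornerN subr_gt0 => Gr Gmr.
by rewrite ltr_norml Gmr andbT ltrNl -subr_gt0 opprK.
Qed.

Lemma is_poly_quo_exact (f g : {poly int}) (P : quasipoly) : g != 0 ->
  (forall n, P n * g.[n] = f.[n]) -> is_poly_quo f g P.
Proof.
move=> g0 Pgf; exists 0; split.
- by apply/val_inj/funext => n; rewrite addr0 -[RHS]/(P n * g.[n]) Pgf.
- exists 1%N, (fun=> 0); split=> [|_]; last by left.
  by split=> // m i; rewrite horner0 subr0.
- have [G_gt0 _] := poly_absP g0; apply: poly_gt0_qp G_gt0 => n.
  by rewrite subr0.
Qed.

(** Write g = c * d with d primitive, so that f = d * s by Gauss's lemma. Then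
    c divides s.[n] as soon as d.[n] is nonzero, so P n := s.[n] / c works for
    all large n. Being an identity of quasi-polynomials, it holds everywhere,
    including at the zeros of g. *)
Lemma poly_quo_exists (f g : {poly int}) : g != 0 ->
  (forall n, (g.[n] %| f.[n])%Z) ->
  exists P : quasipoly, forall n, P n * g.[n] = f.[n].
Proof.
move=> g0 gf; have [s fE] := dvdpP_int (dvdz_horner_dvdp g0 gf).
pose c := zcontents g; pose d := zprimitive g.
have c0 : c != 0 by rewrite zcontents_eq0.
have gE n : g.[n] = c * d.[n] by rewrite {1}[g]zpolyEprim hornerZ.
have d0 : d != 0 by rewrite zprimitive_eq0.
pose P := Quasipoly (qp_divz s c0); exists P => n; apply/eqP; rewrite -subr_eq0.
apply/eqP; apply: (@qp_eventually0 (P * qp_of_poly g - qp_of_poly f)).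
apply: eventually_mp (poly_eventually_neq0 d0) => k dk.
rewrite -[LHS]/((s.[k] %/ c)%Z * g.[k] - f.[k]).
have cs : (c %| s.[k])%Z.
  by have := gf k; rewrite gE fE hornerM [c * _]mulrC dvdz_mul2l.
by rewrite gE fE hornerM mulrA divzK // mulrC subrr.
Qed.

(** The remainder is divisible by g at each point, and smaller than g for large
    n, so it is zero. *)
Lemma poly_quo_exact (f g : {poly int}) : g != 0 ->
  (forall n, (g.[n] %| f.[n])%Z) ->
  forall n, poly_quo f g n * g.[n] = f.[n].
Proof.
move=> g0 gf; have [P Pgf] := poly_quo_exists g0 gf.
have [r [fE r_ge0 r_lt]] : is_poly_quo f g (poly_quo f g).
  by apply: xgetI (is_poly_quo_exact g0 Pgf).
have fEn n : f.[n] = poly_quo f g n * g.[n] + r n.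
  by have := congr1 (fun h : quasipoly => h n) fE.
suff r0 n : r n = 0 by move=> n; rewrite fEn r0 addr0.
apply: qp_eventually0.
have := eventually_and (qp_ge0_eventually r_ge0) (qp_gt0_eventually r_lt).
apply: eventually_mp => k [].
rewrite -[(r - 0) k]/(r k - 0) subr0 => rk.
rewrite -[(_ - r) k]/((poly_abs g).[k] - r k).
rewrite subr_gt0 => rk_lt; apply: (@dvdz_small g.[k]).
  have -> : r k = f.[k] - poly_quo f g k * g.[k] by rewrite fEn; ring.
  by rewrite rpredB // dvdz_mull.
rewrite -(abs_horner_poly_abs _ g0) ger0_norm //.
by rewrite (lt_le_trans rk_lt) ?ler_norm.
Qed.

(** The least common period exists by well-ordering, and for it the classwise
    quotients glue, each of them being a quasi-polynomial. *)
Lemma quoP (f g : quasipoly) : is_quo f g (quo f g).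
Proof.
have [T [rf [rg [rff rgg T_min]]]] : exists T (rf rg : 'I_T -> {poly int}),
    [/\ qp_repr rf f, qp_repr rg g &
      forall (T' : nat) (rf' rg' : 'I_T' -> {poly int}),
        qp_repr rf' f -> qp_repr rg' g -> (T <= T')%N].
  pose period T := `[< exists rf rg : 'I_T -> {poly int},
                         qp_repr rf f /\ qp_repr rg g >].
  have ex_period : exists T, period T.
    by have [T rT] := qp_repr_common (valP f) (valP g); exists T; apply/asboolP.
  have [T /asboolP[rf [rg [rff rgg]]] T_min] := ex_minnP ex_period.
  exists T, rf, rg; split=> // T' rf' rg' h h'; apply: T_min.
  by apply/asboolP; exists rf', rg'.
have [T0 _] := rff.
pose h i : quasipoly := if rg i == 0 then 0 else poly_quo (rf i) (rg i).
have [q qE] := qp_glue h T0.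
apply: (@xgetI _ 0 (is_quo f g) q); exists T, rf, rg.
by split=> // m i; rewrite qE /h; case: ifP.
Qed.

Lemma quo_exact (f g : quasipoly) : qp_dvd g f ->
  forall n, quo f g n * g n = f n.
Proof.
move=> gf; have [T [rf [rg [[T0 rff] [_ rgg] _ quoE]]]] := quoP f g.
move=> n; have [m [i ->]] := int_classP n T0.
have rgf k : ((rg i).[k] %| (rf i).[k])%Z by rewrite -rff -rgg; exact: gf.
rewrite quoE rff rgg; case: eqP => [rg0|/eqP rg0].
  by have := rgf m; rewrite rg0 horner0 dvd0z => /eqP ->; rewrite mul0r.
exact: poly_quo_exact.
Qed.

(** * Determinantal factors from invariant factors *)

Lemma quo_det_factor_mul (m l k : nat) (A : 'M[{poly int}]_(m, l)) :
  (k < m)%N -> (k < l)%N ->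
  forall n, quo (det_factor A k.+1) (det_factor A k) n * det_factor A k n
            = det_factor A k.+1 n.
Proof.
move=> km kl; apply: quo_exact => n.
have [_ DE] := det_factorP k A; have [_ DSE] := det_factorP k.+1 A.
by apply/DSE/minors_dvdS => //; apply/DE.
Qed.

Lemma det_factor_eq_of_inv_factor (m l : nat) (A B : 'M[{poly int}]_(m, l)) :
  (m <= l)%N ->
  (forall k, (1 <= k <= m)%N -> inv_factor A k = inv_factor B k) ->
  forall k, (1 <= k <= m)%N -> det_factor A k = det_factor B k.
Proof.
move=> ml AB; elim=> [//|[|k] IH] /andP[_ km]; first exact: (AB 1%N km).
have kl := leq_trans km ml.
apply/val_inj/funext => n.
rewrite -[LHS](quo_det_factor_mul A km kl) -[RHS](quo_det_factor_mul B km kl).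
by have := AB k.+2 km; rewrite /inv_factor /= IH ?(ltnW km) // => ->.
Qed.

Theorem theorem33 (m l : nat) (A B : 'M[{poly int}]_(m, l)) :
  (0 < m)%N -> (m <= l)%N ->
  [<-> (forall n : int, mx_equiv (eval_mx A n) (eval_mx B n));
       (forall k : nat, (1 <= k <= m)%N -> det_factor A k = det_factor B k);
       (forall k : nat, (1 <= k <= m)%N -> inv_factor A k = inv_factor B k);
       smith A = smith B].
Proof.
move=> m_gt0 ml; tfae.
- move=> AB k _.
  have [A0 AE] := det_factorP k A; have [B0 BE] := det_factorP k B.
  apply: qp_eq_abs => // n; apply: absz_eq_dvdz => t.
  by rewrite AE BE; apply: mx_equiv_minors_dvd.
- move=> AB [|[|k]] // km; rewrite /inv_factor /=; first exact: AB.
  by rewrite !AB //; exact: ltnW km.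
- move=> AB; apply/matrixP=> i j; rewrite !mxE.
  by case: ifP => // _; apply: AB; exact: ltn_ord.
- move=> sAB n; apply: mx_equiv_of_minors_dvd => // k t km.
  rewrite -!(proj2 (det_factorP _ _)).
  rewrite (det_factor_eq_of_inv_factor (B := B) ml _ km) //.
  move=> [//|j] /andP[_ jm].
  have := congr1 (fun S : 'M_(m, l) =>
    S (Ordinal jm) (Ordinal (leq_trans jm ml))) sAB.
  by rewrite !mxE /= eqxx.
Qed.
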